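(* Let $G\rightrightarrows G^{(0)}$ be a Lie groupoid, $\Gamma=T^*G$ its cotangent groupoid with inversion $i_\Gamma$, $\Lambda\subset T^*G\setminus0$ a $G$-relation, and set $\Lambda^\star=i_\Gamma(\Lambda)$. If $A\in I^m(G,\Lambda;\Omega^{1/2})$, then its adjoint satisfies $A^\star\in I^m(G,\Lambda^\star;\Omega^{1/2})$.
   Context: $r,s$ are the range and source of $G$, $i(\gamma)=\gamma^{-1}$. $\Omega^{1/2}=\Omega^{1/2}(\ker dr)\otimes\Omega^{1/2}(\ker ds)$ is the bundle of half densities used for convolution on $G$. The adjoint of a distribution $A\in\mathcal D'(G,\Omega^{1/2})$ is $A^\star(\gamma)=\overline{A(\gamma^{-1})}$, i.e. the complex conjugate of the pull-back of $A$ by $i$. The inversion of the cotangent groupoid $T^*G\rightrightarrows A^*G$ is $i_\Gamma(\gamma,\xi)=(\gamma^{-1},-({}^tdi_\gamma)^{-1}(\xi))$. A $G$-relation is a conic Lagrangian submanifold $\Lambda\subset T^*G\setminus0$ with $\Lambda\cap(\ker dr)^\perp=\Lambda\cap(\ker ds)^\perp=\emptyset$ ($\perp$ denotes the annihilator in $T^*G$). Lagrangian distributions (Hörmander): for a manifold $X$ of dimension $n$, a conic Lagrangian submanifold $\Lambda\subset T^*X\setminus0$ and a complex vector bundle $E$, $I^m(X,\Lambda;E)$ is the set of distributions with values in $E$ which modulo $C^\infty$ are locally finite sums of oscillatory integrals $\int e^{i\phi(x,\theta)}a(x,\theta)\,d\theta$ with $\phi$ a non-degenerate phase function on a conic open subset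 of $U\times(\mathbb R^N\setminus0)$ locally parametrizing $\Lambda$, and $a$ a symbol in $S^{m+(n-2N)/4}$ supported in the interior of a cone with compact base in the domain of $\phi$. *)

(* Defs.v *)
From HB Require Import structures.
From mathcomp Require Import all_boot all_order all_algebra.
From mathcomp Require Import complex.
From mathcomp Require Import all_classical all_reals all_analysis.

Set Implicit Arguments.
Unset Strict Implicit.
Unset Printing Implicit Defensive.

Import Order.TTheory GRing.Theory Num.Theory.
Import numFieldNormedType.Exports.

Local Open Scope classical_set_scope.
Local Open Scope ring_scope.

Section Calculus.
Variable R : realType.

Definition iter_derive (V : normedModType R) (s : seq V) (f : V -> R) : V -> R :=
  foldr (fun v g x => 'D_v g x) f s.

(* [f] is C^oo on the open set [D]: all iterated directional derivatives are
   Frechet differentiable (hence also continuous) at every point of [D]. *)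
Definition smooth_on (V : normedModType R) (D : set V) (f : V -> R) : Prop :=
  forall (s : seq V) (x : V), D x -> differentiable (iter_derive s f) x.

Definition smooth_on_rV (V : normedModType R) (k : nat) (D : set V)
    (f : V -> 'rV[R]_k) : Prop :=
  forall j, smooth_on D (fun x => f x ord0 j).

Definition smooth_on_C (V : normedModType R) (D : set V) (f : V -> R[i]) : Prop :=
  smooth_on D (fun x => complex.Re (f x)) /\
  smooth_on D (fun x => complex.Im (f x)).

Definition basis_rV (n : nat) (j : 'I_n) : 'rV[R]_n := delta_mx ord0 j.

(* Iterated one-dimensional Lebesgue integral; by Fubini it is the Lebesgue
   integral on R^n for the (continuous, compactly supported) integrands to
   which it is applied below. *)
Fixpoint rint (n : nat) : ('rV[R]_n -> R) -> R :=
  match n with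
  | 0 => fun f => f 0
  | n'.+1 => fun f => \int[@lebesgue_measure R]_t
               (@rint n' (fun y => f (row_mx (t%:M : 'rV[R]_1) y)))
  end.

Definition cint (n : nat) (f : 'rV[R]_n -> R[i]) : R[i] :=
  (rint (fun y => complex.Re (f y)) +i* rint (fun y => complex.Im (f y)))%C.

Definition expi (t : R) : R[i] := (cos t +i* sin t)%C.

End Calculus.

Section Manifolds.
Variable R : realType.

(* A topological chart; [cinv] is only meaningful on the image of [cdom]. *)
Record chart (T : topologicalType) (n : nat) := Chart {
  cdom : set T ;
  cmap : T -> 'rV[R]_n ;
  cinv : 'rV[R]_n -> T ;
  cdom_open : open cdom ;
  cimg_open : open (cmap @` cdom) ;
  cmapK : forall x, cdom x -> cinv (cmap x) = x ;
  cmap_continuous : forall x, cdom x -> {for x, continuous cmap} ;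
  cinv_continuous : forall y, (cmap @` cdom) y -> {for y, continuous cinv}
}.

Definition chart_compatible (T : topologicalType) (n : nat) (c c' : chart T n) : Prop :=
  smooth_on_rV (cmap c @` (cdom c `&` cdom c')) (fun y => cmap c' (cinv c y)).

(* Hausdorff second countable smooth manifold of dimension [n], given by its
   maximal atlas. *)
Record manifold (n : nat) := Manifold {
  mpoint :> topologicalType ;
  mhausdorff : hausdorff_space mpoint ;
  msecond : @second_countable mpoint ;
  atlas : set (chart mpoint n) ;
  atlas_cover : forall x, exists2 c, atlas c & cdom c x ;
  atlas_compatible : forall c c', atlas c -> atlas c' -> chart_compatible c c' ;
  atlas_maximal : forall c,
    (forall c', atlas c' -> chart_compatible c c' /\ chart_compatible c' c) -> atlas c
}.

Definition cimg (T : topologicalType) (n : nat) (c : chart T n) : set 'rV[R]_n :=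
  cmap c @` cdom c.

Definition smooth_fun (n : nat) (M : manifold n) (f : M -> R) : Prop :=
  forall c, atlas (m := M) c -> smooth_on (cimg c) (fun y => f (cinv c y)).

Definition smooth_map (n k : nat) (M : manifold n) (M' : manifold k) (f : M -> M') : Prop :=
  continuous f /\
  forall c c', atlas (m := M) c -> atlas (m := M') c' ->
    smooth_on_rV (cmap c @` (cdom c `&` f @^-1` cdom c'))
                 (fun y => cmap c' (f (cinv c y))).

(* Tangent vectors at [x] are the derivations of C^oo(M) at [x].  They are
   encoded as functionals on all functions [M -> R], with value 0 on the
   non-smooth ones so that the encoding is unique. *)
Definition vec (n : nat) (M : manifold n) : Type := (M -> R) -> R.

Definition tangent (n : nat) (M : manifold n) (x : M) (v : vec M) : Prop :=
  [/\ (forall f, ~ smooth_fun f -> v f = 0),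
      (forall (a : R) f g, smooth_fun f -> smooth_fun g ->
         v (fun y => a * f y + g y) = a * v f + v g) &
      (forall f g, smooth_fun f -> smooth_fun g ->
         v (fun y => f y * g y) = v f * g x + f x * v g)].

(* The differential of [f]: [(df v) g = v (g o f)]. *)
Definition tmap (n k : nat) (M : manifold n) (M' : manifold k) (f : M -> M')
    (v : vec M) : vec M' :=
  fun g => if `[< smooth_fun g >] then v (fun x => g (f x)) else 0.

(* The coordinate vector d/dy_j at [x] in the chart [c]. *)
Definition coord_vec (n : nat) (M : manifold n) (c : chart M n) (x : M) (j : 'I_n) : vec M :=
  fun f => if `[< smooth_fun f >]
           then 'D_(basis_rV R j) (fun y => f (cinv c y)) (cmap c x) else 0.

Definition submersion (n k : nat) (M : manifold n) (M' : manifold k) (f : M -> M') : Prop :=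
  smooth_map f /\
  forall x w, tangent (f x) w -> exists2 v, tangent x v & tmap f v = w.

Definition kerd (n k : nat) (M : manifold n) (M' : manifold k) (f : M -> M') (x : M) :
    set (vec M) :=
  [set v | tangent x v /\ tmap f v = (fun=> 0)].

(* Cotangent vectors [(x, xi)]: [xi] is a linear form on the tangent space at
   [x], with value 0 on functionals that are not tangent at [x]. *)
Definition covec (n : nat) (M : manifold n) : Type := (M * (vec M -> R))%type.

Definition cotangent (n : nat) (M : manifold n) (x : M) (xi : vec M -> R) : Prop :=
  (forall v, ~ tangent x v -> xi v = 0) /\
  (forall (a : R) v w, tangent x v -> tangent x w ->
     xi (fun f => a * v f + w f) = a * xi v + xi w).

(* The transpose of the differential of [f] at [x], from the cotangent space at
   [f x] to the cotangent space at [x]. *)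
Definition cotmap (n k : nat) (M : manifold n) (M' : manifold k) (f : M -> M') (x : M)
    (eta : vec M' -> R) : vec M -> R :=
  fun v => if `[< tangent x v >] then eta (tmap f v) else 0.

Definition cotangent_minus0 (n : nat) (M : manifold n) : set (covec M) :=
  [set p | cotangent p.1 p.2 /\ p.2 <> (fun=> 0)].

(* The annihilator of [ker df] in the cotangent bundle. *)
Definition kerd_perp (n k : nat) (M : manifold n) (M' : manifold k) (f : M -> M') :
    set (covec M) :=
  [set p | cotangent p.1 p.2 /\ forall v, kerd f p.1 v -> p.2 v = 0].

(* Canonical coordinates [(y, eta)] on the cotangent bundle. *)
Definition cotcoord (n : nat) (M : manifold n) (c : chart M n) (p : covec M) :
    'rV[R]_n * 'rV[R]_n :=
  (cmap c p.1, \row_j p.2 (coord_vec c p.1 j)).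

Definition cotimg (n : nat) (M : manifold n) (c : chart M n) (L : set (covec M)) :
    set ('rV[R]_n * 'rV[R]_n) :=
  cotcoord c @` (L `&` [set p | cdom c p.1]).

Definition symplectic (n : nat) (a b : 'rV[R]_n * 'rV[R]_n) : R :=
  \sum_(j < n) (a.2 ord0 j * b.1 ord0 j - b.2 ord0 j * a.1 ord0 j).

(* Embedded n-dimensional submanifold of R^n x R^n (locally the zero set of
   n functions with independent differentials) whose tangent spaces are
   isotropic. *)
Definition lagrangian_coord (n : nat) (L : set ('rV[R]_n * 'rV[R]_n)) : Prop :=
  forall p, L p ->
  exists (W : set ('rV[R]_n * 'rV[R]_n)) (F : 'I_n -> 'rV[R]_n * 'rV[R]_n -> R),
    [/\ open W /\ W p,
        (forall j, smooth_on W (F j)),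
        (forall q, W q -> (L q <-> forall j, F j q = 0)),
        (forall e : 'I_n -> R, (forall a, \sum_j e j * 'D_a (F j) p = 0) ->
           forall j, e j = 0) &
        (forall a b, (forall j, 'D_a (F j) p = 0) -> (forall j, 'D_b (F j) p = 0) ->
           symplectic a b = 0)].

Definition conic_lagrangian (n : nat) (M : manifold n) (L : set (covec M)) : Prop :=
  [/\ L `<=` @cotangent_minus0 n M,
      (forall p (t : R), L p -> 0 < t -> L (p.1, fun v => t * p.2 v)) &
      (forall c, atlas (m := M) c -> lagrangian_coord (cotimg c L))].

End Manifolds.

Section LieGroupoids.
Variable R : realType.

(* Lie groupoid with arrows of dimension [n] and units of dimension [k];
   [gmul g h] is only meaningful when [gs g = gr h].  Smoothness of the
   product on the submanifold of composable pairs is expressed by local smooth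
   extension. *)
Record lie_groupoid (n k : nat) := LieGroupoid {
  arrows : manifold R n ;
  units : manifold R k ;
  gr : arrows -> units ;
  gs : arrows -> units ;
  gunit : units -> arrows ;
  ginv : arrows -> arrows ;
  gmul : arrows -> arrows -> arrows ;
  gr_submersion : submersion gr ;
  gs_submersion : submersion gs ;
  gunit_smooth : smooth_map gunit ;
  ginv_smooth : smooth_map ginv ;
  gmul_smooth : forall g h, gs g = gr h ->
    forall c c' c'', atlas (m := arrows) c -> atlas (m := arrows) c' ->
      atlas (m := arrows) c'' ->
      cdom c g -> cdom c' h -> cdom c'' (gmul g h) ->
    exists (W : set ('rV[R]_n * 'rV[R]_n)) (F : 'rV[R]_n * 'rV[R]_n -> 'rV[R]_n),
      [/\ open W, W (cmap c g, cmap c' h), smooth_on_rV W F &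
        forall g' h', gs g' = gr h' -> cdom c g' -> cdom c' h' ->
          W (cmap c g', cmap c' h') ->
          cdom c'' (gmul g' h') /\
          cmap c'' (gmul g' h') = F (cmap c g', cmap c' h')] ;
  gr_unit : forall x, gr (gunit x) = x ;
  gs_unit : forall x, gs (gunit x) = x ;
  gr_mul : forall g h, gs g = gr h -> gr (gmul g h) = gr g ;
  gs_mul : forall g h, gs g = gr h -> gs (gmul g h) = gs h ;
  gmulA : forall g h l, gs g = gr h -> gs h = gr l ->
    gmul g (gmul h l) = gmul (gmul g h) l ;
  gmul1g : forall g, gmul (gunit (gr g)) g = g ;
  gmulg1 : forall g, gmul g (gunit (gs g)) = g ;
  gr_inv : forall g, gr (ginv g) = gs g ;
  gs_inv : forall g, gs (ginv g) = gr g ;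
  gmulgV : forall g, gmul g (ginv g) = gunit (gr g) ;
  gmulVg : forall g, gmul (ginv g) g = gunit (gs g)
}.

Variables (n k : nat) (G : lie_groupoid n k).

Local Notation GA := (arrows G).
(* the common rank of [ker dr] and [ker ds] *)
Local Notation p := (n - k)%N.

(* (g, xi) |-> (g^-1, - (transpose of d_g inv)^-1 (xi)) *)
Definition inv_Gamma (q : covec GA) : covec GA :=
  (ginv q.1,
   - xget 0 [set eta | cotangent (ginv q.1) eta /\ cotmap (@ginv _ _ G) q.1 eta = q.2]).

Definition G_relation (L : set (covec GA)) : Prop :=
  [/\ conic_lagrangian L,
      L `&` kerd_perp (@gr _ _ G) = set0 &
      L `&` kerd_perp (@gs _ _ G) = set0].

Definition is_frame (l : nat) (V : set (vec GA)) (u : 'I_l -> vec GA) : Prop :=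
  [/\ (forall i, V (u i)),
      (forall e : 'I_l -> R, (forall f, \sum_i e i * u i f = 0) -> forall i, e i = 0) &
      (forall v, V v -> exists e : 'I_l -> R, forall f, v f = \sum_i e i * u i f)].

Definition change_frame (l : nat) (a : 'M[R]_l) (u : 'I_l -> vec GA) : 'I_l -> vec GA :=
  fun i f => \sum_j a i j * u j f.

Definition frames (x : GA) (u v : 'I_p -> vec GA) (w : 'I_n -> vec GA) : Prop :=
  [/\ is_frame (kerd (@gr _ _ G) x) u,
      is_frame (kerd (@gs _ _ G) x) v &
      is_frame (tangent x) w].

(* Sections of |ker dr|^al (x) |ker ds|^be (x) |TG|^de, as functions of a point
   and of frames of ker dr, ker ds and TG at that point; the value is 0 when the
   arguments are not such frames. *)
Definition presection : Type :=
  GA -> ('I_p -> vec GA) -> ('I_p -> vec GA) -> ('I_n -> vec GA) -> R[i].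

Definition is_section (al be de : R) (psi : presection) : Prop :=
  (forall x u v w, ~ frames x u v w -> psi x u v w = 0) /\
  (forall x u v w (a b : 'M[R]_p) (d : 'M[R]_n), frames x u v w ->
     a \in unitmx -> b \in unitmx -> d \in unitmx ->
     psi x (change_frame a u) (change_frame b v) (change_frame d w) =
     (`|\det a| `^ al * `|\det b| `^ be * `|\det d| `^ de)%:C%C * psi x u v w).

(* A chart of G together with smooth frames of ker dr and ker ds over its
   domain; it trivializes the above line bundles. *)
Record localtriv := LocalTriv {
  tchart : chart R GA n ;
  tfr : GA -> 'I_p -> vec GA ;
  tfs : GA -> 'I_p -> vec GA ;
  tchart_atlas : atlas (m := GA) tchart ;
  tfr_frame : forall x, cdom tchart x -> is_frame (kerd (@gr _ _ G) x) (tfr x) ;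
  tfs_frame : forall x, cdom tchart x -> is_frame (kerd (@gs _ _ G) x) (tfs x) ;
  tfr_smooth : forall i f, smooth_fun f ->
    smooth_on (cimg tchart) (fun y => tfr (cinv tchart y) i f) ;
  tfs_smooth : forall i f, smooth_fun f ->
    smooth_on (cimg tchart) (fun y => tfs (cinv tchart y) i f)
}.

Definition local_expr (t : localtriv) (psi : presection) (y : 'rV[R]_n) : R[i] :=
  let x := cinv (tchart t) y in
  psi x (tfr t x) (tfs t x) (coord_vec (tchart t) x).

Definition smooth_section (al be de : R) (psi : presection) : Prop :=
  is_section al be de psi /\
  forall t, smooth_on_C (cimg (tchart t)) (local_expr t psi).

Definition supp (psi : presection) : set GA :=
  closure [set x | exists u v w, psi x u v w != 0].

(* Distributions with values in Omega^(1/2) = |ker dr|^(1/2) (x) |ker ds|^(1/2)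
   (generalized sections of this bundle) are the continuous linear forms on
   compactly supported smooth sections of the dual bundle tensored with the
   densities of G, so that the pairing generalizes the integral over G of
   (section of Omega^(1/2)) x (test section). *)
Definition test_section (psi : presection) : Prop :=
  smooth_section (- 2^-1) (- 2^-1) 1 psi /\ compact (supp psi).

Definition functional : Type := presection -> R[i].

Definition is_distribution (A : functional) : Prop :=
  (forall (z : R[i]) psi psi', test_section psi -> test_section psi' ->
     A (fun x u v w => z * psi x u v w + psi' x u v w) = z * A psi + A psi') /\
  (forall (t : localtriv) (K : set 'rV[R]_n), compact K -> K `<=` cimg (tchart t) ->
   exists (C : R) (S : seq (seq 'rV[R]_n)),
   forall psi (B : R), test_section psi ->
     supp psi `<=` cinv (tchart t) @` K ->
     (forall s y, s \in S -> K y ->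
        `|iter_derive s (fun y => complex.Re (local_expr t psi y)) y| <= B /\
        `|iter_derive s (fun y => complex.Im (local_expr t psi y)) y| <= B) ->
     0 <= B -> ComplexField.Normc.normc (A psi) <= C * B).

(* [T] is the distribution given by a C^oo section of Omega^(1/2). *)
Definition is_smooth_distribution (T : functional) : Prop :=
  is_distribution T /\
  exists2 h, smooth_section 2^-1 2^-1 0 h &
  forall (t : localtriv) psi, test_section psi -> supp psi `<=` cdom (tchart t) ->
    T psi = cint (fun y => if y \in cimg (tchart t)
                           then local_expr t h y * local_expr t psi y else 0).

Definition inv_pullback_section (psi : presection) : presection :=
  fun x u v w => if `[< frames x u v w >]
    then psi (ginv x) (fun i => tmap (@ginv _ _ G) (v i))
                      (fun i => tmap (@ginv _ _ G) (u i))
                      (fun i => tmap (@ginv _ _ G) (w i))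
    else 0.

(* The inversion exchanges ker dr and ker ds and is an involution of G, so the
   integral over G of (inv^* A) psi is that of A (inv^* psi). *)
Definition inv_pullback (A : functional) : functional :=
  fun psi => A (inv_pullback_section psi).

Definition conj_functional (A : functional) : functional :=
  fun psi => (A (fun x u v w => (psi x u v w)^*))^*.

Definition adjoint (A : functional) : functional := conj_functional (inv_pullback A).

Section Phases.
Variable N : nat.
Local Notation E := ('rV[R]_n * 'rV[R]_N)%type.

(* [dphi/dtheta = 0] *)
Definition critical (V : set E) (phi : E -> R) : set E :=
  [set q | V q /\ forall w : 'rV[R]_N, 'D_((0, w) : E) phi q = 0].

(* Non-degenerate phase function on the open cone [V] of U x (R^N \ 0). *)
Definition nondegenerate_phase (U : set 'rV[R]_n) (V : set E) (phi : E -> R) : Prop :=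
  [/\ [/\ open V,
          (forall q, V q -> U q.1 /\ q.2 <> 0) &
          (forall q (t : R), V q -> 0 < t -> V (q.1, t *: q.2))],
      smooth_on V phi,
      (forall q (t : R), V q -> 0 < t -> phi (q.1, t *: q.2) = t * phi q),
      (forall q, V q -> exists v : E, 'D_v phi q != 0) &
      (forall q, critical V phi q -> forall e : 'rV[R]_N,
         (forall v : E, 'D_v (fun q' => 'D_((0, e) : E) phi q') q = 0) -> e = 0)].

Definition phase_lagrangian (V : set E) (phi : E -> R) : set ('rV[R]_n * 'rV[R]_n) :=
  [set (q.1, \row_j 'D_((basis_rV R j, 0) : E) phi q) | q in critical V phi].

(* The Lagrangian of [phi] is an open part of [L]. *)
Definition parametrizes (V : set E) (phi : E -> R) (L : set ('rV[R]_n * 'rV[R]_n)) : Prop :=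
  exists2 W : set ('rV[R]_n * 'rV[R]_n), open W & phase_lagrangian V phi = L `&` W.

(* Symbols in S^mu(R^n x R^N). *)
Definition real_symbol (mu : R) (a : E -> R) : Prop :=
  smooth_on setT a /\
  forall (K : set 'rV[R]_n) (s : seq 'rV[R]_n) (s' : seq 'rV[R]_N), compact K ->
  exists C : R, forall (y : 'rV[R]_n) (th : 'rV[R]_N), K y ->
    `|iter_derive ([seq ((v, 0) : E) | v <- s] ++ [seq ((0, w) : E) | w <- s']) a (y, th)|
      <= C * (1 + `|th|) `^ (mu - (size s')%:R).

Definition symbol (mu : R) (a : E -> R[i]) : Prop :=
  real_symbol mu (fun q => complex.Re (a q)) /\
  real_symbol mu (fun q => complex.Im (a q)).

Definition supported_in_cone (V : set E) (a : E -> R[i]) : Prop :=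
  exists B : set E, [/\ compact B, B `<=` V &
    closure [set q | a q != 0] `<=`
    interior [set q | exists2 b, B b & exists2 t : R, 0 < t & q = (b.1, t *: b.2)]].

(* [l] is the oscillatory integral of exp(i phi(y,th)) a(y,th) f(y) dth dy,
   defined by the usual cut-off regularization in th. *)
Definition oscillatory_integral (phi : E -> R) (a : E -> R[i]) (f : 'rV[R]_n -> R[i])
    (l : R[i]) : Prop :=
  forall chi : 'rV[R]_N -> R,
    smooth_on setT chi -> compact (closure [set th | chi th != 0]) ->
    (\forall th \near (0 : 'rV[R]_N), chi th = 1) ->
    let I (e : R) := cint (fun y => cint (fun th =>
      expi (phi (y, th)) * (chi (e *: th))%:C%C * a (y, th) * f y)) in
    complex.Re (I e) @[e --> 0^'+] --> complex.Re l /\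
    complex.Im (I e) @[e --> 0^'+] --> complex.Im l.

End Phases.

(* The distribution [O] is, in some local trivialization, the oscillatory integral
   of exp(i phi) a dth with phi parametrizing [L] and a of order m + (n - 2N)/4. *)
Definition oscillatory_distribution (m : R) (L : set (covec GA)) (O : functional) : Prop :=
  exists (t : localtriv) (N : nat) (V : set ('rV[R]_n * 'rV[R]_N))
         (phi : 'rV[R]_n * 'rV[R]_N -> R) (a : 'rV[R]_n * 'rV[R]_N -> R[i]),
    [/\ nondegenerate_phase (cimg (tchart t)) V phi,
        parametrizes V phi (cotimg (tchart t) L),
        symbol (m + (n%:R - 2 * N%:R) / 4) a,
        supported_in_cone V a &
        forall psi, test_section psi ->
          oscillatory_integral phi a (local_expr t psi) (O psi)].

Definition locally_finite (J : set nat) (O : nat -> functional) : Prop :=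
  forall x : GA, exists2 W : set GA, open W /\ W x &
    finite_set [set j | J j /\
      exists2 psi, test_section psi /\ supp psi `<=` W & O j psi != 0].

(* [I^m(G, L; Omega^(1/2))]; countable index sets suffice because G is second
   countable. *)
Definition lagrangian_distribution (m : R) (L : set (covec GA)) (A : functional) : Prop :=
  is_distribution A /\
  exists (J : set nat) (O : nat -> functional),
    [/\ (forall j, J j -> oscillatory_distribution m L (O j)),
        locally_finite J O &
        is_smooth_distribution (fun psi => A psi - \sum_(j \in J) O j psi)].

End LieGroupoids.

(* Main.v *)
(** If [c] is a chart of [G], then so is [c \o inv], and [d inv] exchanges
    [ker dr] and [ker ds]; so inversion carries a local trivialization [t] to
    another one, [inv_triv t], and in these two trivializations the pull-back of
    sections by inversion leaves the coordinate expressions unchanged.  Hence the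
    adjoint merely conjugates local expressions: an oscillatory integral with
    phase [phi] and symbol [a] becomes the one with phase [- phi] and symbol
    [a^*].  The phase [- phi] parametrizes the image of the Lagrangian under
    [(y, eta) |-> (y, - eta)], which is [inv_Gamma] in canonical coordinates. *)

Require Import Defs.
From mathcomp Require Import all_boot all_order all_algebra.
From mathcomp Require Import complex.
From mathcomp Require Import all_classical all_reals all_analysis.

Local Open Scope classical_set_scope.
Local Open Scope ring_scope.

Import Order.TTheory GRing.Theory Num.Theory.
Import numFieldNormedType.Exports.

(** * Derivatives, integrals and sums under negation and conjugation *)

Section Calculus.
Context {R : realType}.

(* The limit of a divergent difference quotient is the junk value [0]. *)
Lemma deriveN_total (V : normedModType R) (f : V -> R) (v x : V) :
  'D_v (- f) x = - 'D_v f x.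
Proof.
have [df|Ndf] := pselect (derivable f x v); first exact: deriveN.
have NdNf : ~ derivable (- f) x v by move=> /derivableN; rewrite opprK.
by rewrite /derive (dvgP Ndf) (dvgP NdNf) oppr0.
Qed.

Lemma iter_deriveN (V : normedModType R) (s : seq V) (f : V -> R) :
  iter_derive s (- f) = - iter_derive s f.
Proof.
elim: s => //= v s ->; apply/funext => x; exact: deriveN_total.
Qed.

Lemma smooth_onN (V : normedModType R) (D : set V) (f : V -> R) :
  smooth_on D f -> smooth_on D (- f).
Proof.
by move=> sf s x Dx; rewrite iter_deriveN; apply: differentiableN; exact: sf.
Qed.

(** A derivative sees only the germ of a function, and openness of [D] turns equality on [D] into
    equality near each of its points. Local expressions are compared only on chart images, hence the
    restriction to [D]. *)
Lemma iter_derive_open_eq {V : normedModType R} {D : set V} {f g : V -> R} (s : seq V) :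
  open D -> {in D, f =1 g} -> {in D, iter_derive s f =1 iter_derive s g}.
Proof.
move=> oD fg; elim: s => //= v s IH x /set_mem Dx.
apply: near_eq_derive; apply: filterS (open_nbhs_nbhs (conj oD Dx)) => y Dy.
exact/IH/mem_set.
Qed.

Lemma near_eq_differentiable {V W : normedModType R} {f g : V -> W} {x : V} :
  {near x, f =1 g} -> differentiable f x -> differentiable g x.
Proof.
move=> fg df.
have cdf : continuous ('d f x) by exact: diff_continuous.
(* The differential of [f] also fits the first-order expansion of [g], since the two remainders
   coincide near [0]. *)
have gE : g \o shift x = cst (g x) + 'd f x +o_ 0 id.
  apply/eqaddoP => e e0; have /eqaddoP/(_ e e0) := diff_locally df.
  have fg0 : \forall h \near 0, f (h + x) = g (h + x).
    by move: fg; rewrite (near_shift 0 x); apply: filterS => h; rewrite /= subr0.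
  apply: filter_app; move: fg0; apply: filterS => h /= fgh.
  by rewrite /= !fctE /= fgh (nbhs_singleton fg).
by apply/diff_locallyP; rewrite (diff_unique cdf gE).
Qed.

Lemma smooth_on_eq {V : normedModType R} {D : set V} {f g : V -> R} :
  open D -> {in D, f =1 g} -> smooth_on D f -> smooth_on D g.
Proof.
move=> oD fg sf s x Dx; apply: near_eq_differentiable (sf s x Dx).
apply: filterS (open_nbhs_nbhs (conj oD Dx)) => y Dy.
exact/(iter_derive_open_eq s oD fg)/mem_set.
Qed.

Lemma ReC (z : R[i]) : complex.Re z^* = complex.Re z.
Proof. by case: z. Qed.

Lemma ImC (z : R[i]) : complex.Im z^* = - complex.Im z.
Proof. by case: z. Qed.

Lemma smooth_on_C_conj (V : normedModType R) (D : set V) (f : V -> R[i]) :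
  smooth_on_C D f -> smooth_on_C D (fun y => (f y)^*).
Proof.
case=> sRe sIm; split; first by under eq_fun do rewrite ReC.
by under eq_fun do rewrite ImC; exact: (@smooth_onN _ _ (fun y => complex.Im (f y))).
Qed.

Lemma smooth_on_C_eq {V : normedModType R} {D : set V} {f g : V -> R[i]} :
  open D -> {in D, f =1 g} -> smooth_on_C D f -> smooth_on_C D g.
Proof.
move=> oD fg [sRe sIm]; split.
- by apply: smooth_on_eq sRe => // y Dy; rewrite fg.
- by apply: smooth_on_eq sIm => // y Dy; rewrite fg.
Qed.

(* In the indeterminate case [fine] sends both sides to [0]. *)
Lemma RintegralN_total {d} {T : measurableType d} (mu : {measure set T -> \bar R})
    (D : set T) (f : T -> R) :
  Rintegral mu D (fun x => - f x) = - Rintegral mu D f.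
Proof.
rewrite /Rintegral [in LHS]integralE [in RHS]integralE.
have -> : (fun x => (- f x)%:E) = (\- (EFin \o f))%E by [].
rewrite funeposN funenegN; set a := (integral mu D _); set b := (integral mu D _).
by case: a => [a| |]; case: b => [b| |] //=; rewrite ?opprB ?oppr0.
Qed.

Lemma rintN (n : nat) (f : 'rV[R]_n -> R) : rint (fun y => - f y) = - rint f.
Proof.
elim: n f => //= n IH f; rewrite -RintegralN_total; congr Rintegral.
by apply/funext => t; exact: IH.
Qed.

Lemma cint_conj (n : nat) (f : 'rV[R]_n -> R[i]) : cint (fun y => (f y)^*) = (cint f)^*.
Proof.
rewrite /cint /=; congr (_ +i* _)%C; first by under eq_fun do rewrite ReC.
by under eq_fun do rewrite ImC; exact: rintN.
Qed.

Lemma expiN (t : R) : expi (- t) = (expi t)^*.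
Proof. by rewrite /expi cosN sinN. Qed.

Lemma normc_conj (z : R[i]) : ComplexField.Normc.normc z^* = ComplexField.Normc.normc z.
Proof. by case: z => a b /=; rewrite sqrrN. Qed.

Lemma conj_real (x : R) : (x%:C%C : R[i])^* = x%:C%C.
Proof. exact: conjc_real. Qed.

Lemma fsum_conj (J : set nat) (F : nat -> R[i]) :
  (\sum_(j \in J) F j)^* = \sum_(j \in J) (F j)^*.
Proof.
rewrite rmorph_sum /=.
(* The indices actually summed over are computed from where the summand is nonzero, and conjugation
   does not change that set. *)
suff FE : F @^-1` [set~ 0] = (fun j => (F j)^*) @^-1` [set~ 0].
  by rewrite /finite_support !unlock FE.
by apply/seteqP; split=> j /= /eqP Fj; apply/eqP; rewrite conjC_eq0 in Fj *.
Qed.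

End Calculus.

(** * Charts composed with the groupoid inversion *)

Section InverseChart.
Set Implicit Arguments.
Unset Strict Implicit.
Context {R : realType} {n k : nat} {G : lie_groupoid R n k}.
Local Notation GA := (arrows G).
Local Notation inv := (@ginv R n k G).

(** Bracket the product of [inv (inv g)], [inv g] and [g] in the two possible ways. *)
Lemma ginvK : involutive inv.
Proof.
move=> g.
have e1 : gs (inv (inv g)) = gr (inv g) by rewrite gs_inv.
have e2 : gs (inv g) = gr g by rewrite gs_inv.
have := gmulA e1 e2; rewrite !gmulVg gs_inv gmul1g => e.
by rewrite -[RHS]e -gr_inv -gs_inv gmulg1.
Qed.

Lemma ginv_continuous : continuous inv.
Proof. by case: (ginv_smooth G). Qed.

Lemma open_ginv_preimage (D : set GA) : open D -> open (inv @^-1` D).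
Proof. by move=> oD; apply: open_comp oD => x _; exact: ginv_continuous. Qed.

Section Chart.
Variable c : chart R GA n.

(** Because the image is the same, expressions in the two charts can be compared at one and the same
    coordinate [y]. *)
Let cimg_inv : (cmap c \o inv) @` (inv @^-1` cdom c) = cimg c.
Proof.
apply/seteqP; split=> [_ [x /= cx <-]|_ [x cx <-]]; first by exists (inv x).
by exists (inv x); rewrite /= ginvK.
Qed.

Lemma inv_chart_img_open : open ((cmap c \o inv) @` (inv @^-1` cdom c)).
Proof. rewrite cimg_inv; exact: cimg_open. Qed.

Lemma inv_chartK x : (inv @^-1` cdom c) x -> (inv \o cinv c) ((cmap c \o inv) x) = x.
Proof. by move=> cx /=; rewrite cmapK// ginvK. Qed.

Lemma inv_chart_map_continuous x :
  (inv @^-1` cdom c) x -> {for x, continuous (cmap c \o inv)}.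
Proof.
by move=> cx; apply: continuous_comp; [exact: ginv_continuous|exact: cmap_continuous].
Qed.

Lemma inv_chart_inv_continuous y : ((cmap c \o inv) @` (inv @^-1` cdom c)) y ->
  {for y, continuous (inv \o cinv c)}.
Proof.
rewrite cimg_inv => cy.
by apply: continuous_comp; [exact: cinv_continuous|exact: ginv_continuous].
Qed.

Definition inv_chart : chart R GA n :=
  Chart (open_ginv_preimage (cdom_open c)) inv_chart_img_open inv_chartK
    inv_chart_map_continuous inv_chart_inv_continuous.

Lemma cimg_inv_chart : cimg inv_chart = cimg c.
Proof. exact: cimg_inv. Qed.

(** By maximality only the transition maps with charts of the atlas matter, and in both directions
    these are coordinate expressions of the smooth map [inv]. *)
Lemma inv_chart_atlas : atlas c -> atlas inv_chart.
Proof.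
move=> ac; apply: atlas_maximal => c' ac'; have [_ sm] := ginv_smooth G; split.
- move: (sm c c' ac ac'); rewrite /chart_compatible /=.
  suff -> : (cmap c \o inv) @` (inv @^-1` cdom c `&` cdom c') =
            cmap c @` (cdom c `&` inv @^-1` cdom c') by [].
  apply/seteqP; split=> [_ [x [/= cx c'x] <-]|_ [x [cx /= c'x] <-]].
    by exists (inv x) => //; split; rewrite /= ?ginvK.
  by exists (inv x) => //=; rewrite ?ginvK.
- exact: sm.
Qed.

End Chart.

Lemma smooth_fun_ginv (f : GA -> R) : smooth_fun f -> smooth_fun (f \o inv).
Proof.
move=> sf c ac; have := sf _ (inv_chart_atlas ac).
by rewrite cimg_inv_chart.
Qed.

Lemma smooth_fun_ginvE (f : GA -> R) : smooth_fun (f \o inv) <-> smooth_fun f.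
Proof.
split; last exact: smooth_fun_ginv.
move=> /smooth_fun_ginv; rewrite -compA.
by have -> : inv \o inv = id by apply/funext => x; exact: ginvK.
Qed.

End InverseChart.

(** * Tangent vectors, frames and trivializations under inversion *)

Section InverseFrames.
Set Implicit Arguments.
Unset Strict Implicit.
Context {R : realType} {n k : nat} {G : lie_groupoid R n k}.
Local Notation GA := (arrows G).
Local Notation inv := (@ginv R n k G).
Local Notation r := (@gr R n k G).
Local Notation s := (@gs R n k G).
Local Notation dinv := (tmap inv : vec GA -> vec GA).

(* For such [v], [tmap inv v] is [v (_ \o inv)] even on non-smooth functions. *)
Definition null_off_smooth (v : vec GA) := forall f, ~ smooth_fun f -> v f = 0.

Lemma dinv_null v : null_off_smooth (dinv v).
Proof. by move=> f Nf; rewrite /tmap asboolF. Qed.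

Lemma dinvE (v : vec GA) f : null_off_smooth v -> dinv v f = v (f \o inv).
Proof.
by move=> v0; rewrite /tmap; case: asboolP => // Nf; rewrite v0// smooth_fun_ginvE.
Qed.

Lemma dinvK (v : vec GA) : null_off_smooth v -> dinv (dinv v) = v.
Proof.
move=> v0; apply/funext => f; rewrite dinvE; last exact: dinv_null.
by rewrite dinvE//; congr v; apply/funext => x /=; rewrite ginvK.
Qed.

Lemma tangent_null x (v : vec GA) : tangent x v -> null_off_smooth v.
Proof. by case. Qed.

Lemma tangent_dinv x (v : vec GA) : tangent x v -> tangent (inv x) (dinv v).
Proof.
move=> tv; have v0 := tangent_null tv; have [_ vD vM] := tv; split.
- exact: dinv_null.
- by move=> a f g sf sg; rewrite !dinvE// -vD//; exact: smooth_fun_ginv.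
- move=> f g sf sg; rewrite !dinvE//.
  exact: vM _ _ (smooth_fun_ginv sf) (smooth_fun_ginv sg).
Qed.

Lemma tangent_dinvE x (v : vec GA) :
  null_off_smooth v -> tangent (inv x) (dinv v) <-> tangent x v.
Proof.
move=> v0; split; last exact: tangent_dinv.
by move=> /tangent_dinv; rewrite ginvK dinvK.
Qed.

(** Since [gs (inv y) = gr y], applying [ds] after [dinv] amounts to applying [dr]. *)
Lemma kerd_gr_dinv x v : kerd r x v -> kerd s (inv x) (dinv v).
Proof.
case=> tv rv; split; first exact: tangent_dinv.
rewrite -rv; apply/funext => f; rewrite /tmap; case: asboolP => // sf.
rewrite -/(tmap _ _ _) dinvE; last exact: tangent_null tv.
by congr v; apply/funext => y /=; rewrite gs_inv.
Qed.

Lemma kerd_gs_dinv x v : kerd s x v -> kerd r (inv x) (dinv v).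
Proof.
case=> tv sv; split; first exact: tangent_dinv.
rewrite -sv; apply/funext => f; rewrite /tmap; case: asboolP => // sf.
rewrite -/(tmap _ _ _) dinvE; last exact: tangent_null tv.
by congr v; apply/funext => y /=; rewrite gr_inv.
Qed.

(** Common argument for [ker dr], [ker ds] and the tangent space: [dinv] maps [V] to [V'] and back.
    Vanishing on non-smooth functions is what makes [dinv] its own inverse there. *)
Lemma is_frame_dinv (l : nat) (V V' : set (vec GA)) (u : 'I_l -> vec GA) :
  (forall v, V v -> null_off_smooth v) -> (forall v, V' v -> null_off_smooth v) ->
  (forall v, V v -> V' (dinv v)) -> (forall v, V' v -> V (dinv v)) ->
  is_frame V u -> is_frame V' (fun i => dinv (u i)).
Proof.
move=> V0 V'0 VV' V'V [Vu uI uS]; have u0 i := V0 _ (Vu i); split.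
- by move=> i; exact: VV'.
- move=> e e0; apply: uI => f.
  (* Evaluating the relation at [f \o inv] undoes [dinv]. *)
  rewrite -[RHS](e0 (f \o inv)); apply: eq_bigr => i _; congr (_ * _).
  by rewrite dinvE//; congr (u i); apply/funext => x /=; rewrite ginvK.
- move=> v V'v; have [e ve] := uS _ (V'V _ V'v); exists e => f.
  rewrite -[v in LHS]dinvK; last exact: V'0.
  rewrite dinvE; last exact: dinv_null.
  by rewrite ve; apply: eq_bigr => i _; rewrite dinvE.
Qed.

Lemma frame_kerd_gr_dinv l x (u : 'I_l -> vec GA) :
  is_frame (kerd r x) u -> is_frame (kerd s (inv x)) (fun i => dinv (u i)).
Proof.
apply: is_frame_dinv => v; [by case=> /tangent_null|by case=> /tangent_null| |].
- exact: kerd_gr_dinv.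
- by move=> /kerd_gs_dinv; rewrite ginvK.
Qed.

Lemma frame_kerd_gs_dinv l x (u : 'I_l -> vec GA) :
  is_frame (kerd s x) u -> is_frame (kerd r (inv x)) (fun i => dinv (u i)).
Proof.
apply: is_frame_dinv => v; [by case=> /tangent_null|by case=> /tangent_null| |].
- exact: kerd_gs_dinv.
- by move=> /kerd_gr_dinv; rewrite ginvK.
Qed.

Lemma frame_tangent_dinv l x (u : 'I_l -> vec GA) :
  is_frame (tangent x) u -> is_frame (tangent (inv x)) (fun i => dinv (u i)).
Proof.
apply: is_frame_dinv => v; [exact: tangent_null|exact: tangent_null| |].
- exact: tangent_dinv.
- by move=> /tangent_dinv; rewrite ginvK.
Qed.

Lemma frames_dinv x (u v : 'I_(n - k) -> vec GA) (w : 'I_n -> vec GA) :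
  frames x u v w ->
  frames (inv x) (fun i => dinv (v i)) (fun i => dinv (u i)) (fun i => dinv (w i)).
Proof.
case=> fu fv fw; split; [exact: frame_kerd_gs_dinv|exact: frame_kerd_gr_dinv|].
exact: frame_tangent_dinv.
Qed.

Lemma frames_null x (u v : 'I_(n - k) -> vec GA) (w : 'I_n -> vec GA) :
  frames x u v w -> [/\ forall i, null_off_smooth (u i),
    forall i, null_off_smooth (v i) & forall i, null_off_smooth (w i)].
Proof.
case=> -[fu _ _] [fv _ _] [fw _ _]; split=> i; [case: (fu i)|case: (fv i)|];
  by [move=> /tangent_null|exact: tangent_null (fw i)].
Qed.

Lemma dinv_change_frame l (a : 'M[R]_l) (u : 'I_l -> vec GA) :
  (fun i => dinv (change_frame a u i)) = change_frame a (fun i => dinv (u i)).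
Proof.
apply/funext => i; apply/funext => f; rewrite /change_frame /tmap.
by case: asboolP => // _; rewrite big1// => j _; rewrite mulr0.
Qed.

Lemma change_frame_null l (a : 'M[R]_l) (u : 'I_l -> vec GA) i :
  (forall i, null_off_smooth (u i)) -> null_off_smooth (change_frame a u i).
Proof. by move=> u0 f Nf; apply: big1 => j _; rewrite u0 ?mulr0. Qed.

Lemma coord_vec_null c x i : null_off_smooth (coord_vec (M := GA) c x i).
Proof. by move=> f Nf; rewrite /coord_vec asboolF. Qed.

(** Both sides differentiate [f \o inv \o cinv c] at [cmap c x]. Hence no Jacobian enters when
    densities are pulled back. *)
Lemma dinv_coord_vec (c : chart R GA n) x :
  (fun i => dinv (coord_vec (M := GA) c x i)) = coord_vec (inv_chart c) (inv x).
Proof.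
apply/funext => i; apply/funext => f; rewrite dinvE; last exact: coord_vec_null.
by rewrite /coord_vec /= ginvK (asbool_equiv_eq (smooth_fun_ginvE f)).
Qed.

Lemma cinv_img (c : chart R GA n) y : cimg c y -> cdom c (cinv c y).
Proof. by case=> x cx <-; rewrite cmapK. Qed.

Section LocalTriv.
Variable t : localtriv G.

(** The two families trade places, matching the order in which [inv_pullback_section] passes frames
    to its argument. *)
Let tfr' x i := dinv (tfs t (inv x) i).
Let tfs' x i := dinv (tfr t (inv x) i).

Let tfr'_frame x : cdom (inv_chart (tchart t)) x -> is_frame (kerd r x) (tfr' x).
Proof. by move=> /tfs_frame/frame_kerd_gs_dinv; rewrite ginvK. Qed.

Let tfs'_frame x : cdom (inv_chart (tchart t)) x -> is_frame (kerd s x) (tfs' x).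
Proof. by move=> /tfr_frame/frame_kerd_gr_dinv; rewrite ginvK. Qed.

Let tfr'_smooth i f : smooth_fun f ->
  smooth_on (cimg (inv_chart (tchart t)))
    (fun y => tfr' (cinv (inv_chart (tchart t)) y) i f).
Proof.
move=> sf; rewrite cimg_inv_chart.
apply: smooth_on_eq (tfs_smooth i (smooth_fun_ginv sf)); first exact: cimg_open.
by move=> y _; rewrite /tfr' /= ginvK /tmap asboolT.
Qed.

Let tfs'_smooth i f : smooth_fun f ->
  smooth_on (cimg (inv_chart (tchart t)))
    (fun y => tfs' (cinv (inv_chart (tchart t)) y) i f).
Proof.
move=> sf; rewrite cimg_inv_chart.
apply: smooth_on_eq (tfr_smooth i (smooth_fun_ginv sf)); first exact: cimg_open.
by move=> y _; rewrite /tfs' /= ginvK /tmap asboolT.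
Qed.

Definition inv_triv : localtriv G :=
  LocalTriv (inv_chart_atlas (tchart_atlas t)) tfr'_frame tfs'_frame
    tfr'_smooth tfs'_smooth.

End LocalTriv.
End InverseFrames.

(** * Adjoints of sections and of distributions *)

Section Adjoint.
Set Implicit Arguments.
Unset Strict Implicit.
Context {R : realType} {n k : nat} {G : lie_groupoid R n k}.
Local Notation GA := (arrows G).
Local Notation inv := (@ginv R n k G).
Local Notation dinv := (tmap inv : vec GA -> vec GA).
Local Notation pullback := (@inv_pullback_section R n k G).

Definition null_off_frames (psi : presection G) :=
  forall x u v w, ~ frames x u v w -> psi x u v w = 0.

(** If [u], [v], [w] are not frames at [x], their images are not frames at [inv x], because a second
    application of [dinv] would recover the originals; both sides are then [0]. *)
Lemma inv_pullbackE (psi : presection G) x u v w : null_off_frames psi ->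
  (forall i, null_off_smooth (u i)) -> (forall i, null_off_smooth (v i)) ->
  (forall i, null_off_smooth (w i)) ->
  pullback psi x u v w =
  psi (inv x) (fun i => dinv (v i)) (fun i => dinv (u i)) (fun i => dinv (w i)).
Proof.
move=> psi0 u0 v0 w0; rewrite /inv_pullback_section; case: asboolP => // Nf.
rewrite psi0// => /frames_dinv; rewrite ginvK => f'; apply: Nf.
suff dK l (z : 'I_l -> vec GA) : (forall i, null_off_smooth (z i)) ->
  (fun i => dinv (dinv (z i))) = z by rewrite !dK in f'.
by move=> z0; apply/funext => i; exact: dinvK.
Qed.

Lemma inv_pullback_null_off_frames (psi : presection G) : null_off_frames (pullback psi).
Proof. by move=> x u v w Nf; rewrite /inv_pullback_section asboolF. Qed.

Lemma inv_pullbackK (psi : presection G) : null_off_frames psi ->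
  pullback (pullback psi) = psi.
Proof.
move=> psi0; apply/funext => x; apply/funext => u; apply/funext => v; apply/funext => w.
have [fr|Nf] := pselect (frames x u v w); last first.
  by rewrite psi0// /inv_pullback_section asboolF.
have [u0 v0 w0] := frames_null fr.
rewrite inv_pullbackE//; last exact: inv_pullback_null_off_frames.
rewrite inv_pullbackE//; try by move=> i; exact: dinv_null.
rewrite ginvK; congr psi; apply/funext => i; exact: dinvK.
Qed.

Lemma local_expr_pullback (t : localtriv G) (psi : presection G) y :
  null_off_frames psi -> cimg (tchart t) y ->
  local_expr t (pullback psi) y = local_expr (inv_triv t) psi y.
Proof.
move=> psi0 /cinv_img cy; rewrite /local_expr inv_pullbackE//.
- rewrite dinv_coord_vec; congr (psi _ _ _ _); apply/funext => i /=; by rewrite ginvK.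
- by move=> i; have [/(_ i)[/tangent_null]] := tfr_frame cy.
- by move=> i; have [/(_ i)[/tangent_null]] := tfs_frame cy.
- by move=> i; exact: coord_vec_null.
Qed.

Lemma local_expr_inv_triv_pullback (t : localtriv G) (psi : presection G) y :
  null_off_frames psi -> cimg (tchart t) y ->
  local_expr (inv_triv t) (pullback psi) y = local_expr t psi y.
Proof.
move=> psi0 cy; rewrite -local_expr_pullback ?inv_pullbackK//.
exact: inv_pullback_null_off_frames.
Qed.

(** The exponents on [ker dr] and [ker ds] are equal because the pull-back exchanges the two frames:
    their determinant factors then merely commute. *)
Lemma inv_pullback_is_section (al de : R) psi :
  is_section al al de psi -> is_section al al de (pullback psi).
Proof.
case=> psi0 psiE; split; first exact: inv_pullback_null_off_frames.
move=> x u v w a b d fr ua ub ud; have [u0 v0 w0] := frames_null fr.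
rewrite !inv_pullbackE//; try by move=> i; exact: change_frame_null.
rewrite !dinv_change_frame psiE//; last exact: frames_dinv.
by rewrite [X in (X * _)%:C%C]mulrC.
Qed.

Lemma inv_pullback_smooth (al de : R) psi :
  smooth_section al al de psi -> smooth_section al al de (pullback psi).
Proof.
case=> psiS psis; split; first exact: inv_pullback_is_section.
move=> t; have := psis (inv_triv t); rewrite cimg_inv_chart.
apply: smooth_on_C_eq; first exact: cimg_open.
by move=> y /set_mem cy; rewrite local_expr_pullback//; case: psiS.
Qed.

(** The image of the support under [inv] is compact, hence closed in a Hausdorff space, so it
    contains the closure defining the new support. *)
Lemma supp_inv_pullback psi : compact (supp psi) ->
  compact (supp (pullback psi)) /\ supp (pullback psi) `<=` inv @` supp psi.
Proof.
move=> cpsi.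
have cinvs : compact (inv @` supp psi).
  by apply: continuous_compact => //; apply: continuous_subspaceT; exact: ginv_continuous.
have sub : supp (pullback psi) `<=` inv @` supp psi.
  apply: subset_trans (compact_closed (@mhausdorff _ _ GA) cinvs).
  apply: closure_subset => x [u [v [w]]]; rewrite /inv_pullback_section.
  case: asboolP => [_ psin0|_ /eqP//]; exists (inv x); last exact: ginvK.
  by apply: subset_closure; do 3 eexists; exact: psin0.
by split=> //; apply: subclosed_compact cinvs sub; exact: closed_closure.
Qed.

Definition conj_section (psi : presection G) : presection G :=
  fun x u v w => (psi x u v w)^*.

Lemma conj_section_smooth (al be de : R) psi :
  smooth_section al be de psi -> smooth_section al be de (conj_section psi).
Proof.
case=> -[psi0 psiE] psis; split; first split.
- by move=> x u v w Nf; rewrite /conj_section psi0// conjC0.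
- by move=> *; rewrite /conj_section psiE// rmorphM /= conj_real.
- by move=> t; exact: smooth_on_C_conj (psis t).
Qed.

Lemma supp_conj_section psi : supp (conj_section psi) = supp psi.
Proof.
congr closure; apply/seteqP; split=> x [u [v [w n0]]]; exists u, v, w;
  by rewrite conjC_eq0 in n0 *.
Qed.

(** It serves twice: on test sections, where [adjoint] is dual to it, and on smooth kernels, where
    it is the adjoint itself. *)
Definition adj_section psi := pullback (conj_section psi).

Lemma adjointE (A : functional G) psi : adjoint A psi = (A (adj_section psi))^*.
Proof. by []. Qed.

Lemma adj_section_smooth (al de : R) psi :
  smooth_section al al de psi -> smooth_section al al de (adj_section psi).
Proof. by move=> ?; apply: inv_pullback_smooth; exact: conj_section_smooth. Qed.

Lemma test_adj_section psi : test_section psi ->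
  test_section (adj_section psi) /\ supp (adj_section psi) `<=` inv @` supp psi.
Proof.
case=> spsi; rewrite -supp_conj_section => /supp_inv_pullback[c s].
by split=> //; split=> //; exact: adj_section_smooth.
Qed.

Lemma local_expr_adj_section (al be de : R) (t : localtriv G) psi y :
  smooth_section al be de psi -> cimg (tchart t) y ->
  local_expr t (adj_section psi) y = (local_expr (inv_triv t) psi y)^*.
Proof.
by move=> /conj_section_smooth[[psi0 _] _] cy; rewrite local_expr_pullback.
Qed.

Lemma local_expr_inv_triv_adj_section (al be de : R) (t : localtriv G) psi y :
  smooth_section al be de psi -> cimg (tchart t) y ->
  local_expr (inv_triv t) (adj_section psi) y = (local_expr t psi y)^*.
Proof.
by move=> /conj_section_smooth[[psi0 _] _] cy; rewrite local_expr_inv_triv_pullback.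
Qed.

Lemma adj_section_linear (z : R[i]) (psi psi' : presection G) :
  adj_section (fun x u v w => z * psi x u v w + psi' x u v w) =
  (fun x u v w => z^* * adj_section psi x u v w + adj_section psi' x u v w).
Proof.
apply/funext => x; apply/funext => u; apply/funext => v; apply/funext => w.
rewrite /adj_section /inv_pullback_section; case: asboolP => _.
  by rewrite /conj_section rmorphD rmorphM.
by rewrite mulr0 addr0.
Qed.

Lemma adjoint_is_distribution (A : functional G) :
  is_distribution A -> is_distribution (adjoint A).
Proof.
case=> Alin Acont; split.
- move=> z psi psi' tpsi tpsi'; rewrite !adjointE adj_section_linear Alin.
  + by rewrite rmorphD rmorphM /= conjCK.
  + exact: (test_adj_section tpsi).1.
  + exact: (test_adj_section tpsi').1.
- move=> t K cK Kt.
  have Kt' : K `<=` cimg (tchart (inv_triv t)) by rewrite cimg_inv_chart.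
  (* The estimate of [A] in [inv_triv t] carries over with the same [K], [C] and [S]: the
     expressions there are the conjugates of those in [t]. *)
  have [C [S AC]] := Acont (inv_triv t) K cK Kt'; exists C, S => psi B tpsi sK bB B0.
  have [tpsi' spsi'] := test_adj_section tpsi.
  rewrite adjointE normc_conj; apply: AC => //.
    by move=> _ /spsi'[x /sK[y Ky <-] <-]; exists y.
  move=> s y sS Ky; have [bRe bIm] := bB s y sS Ky.
  have E : {in cimg (tchart t),
      local_expr (inv_triv t) (adj_section psi) =1 fun y => (local_expr t psi y)^*}.
    by move=> z /set_mem cz; exact: local_expr_inv_triv_adj_section tpsi.1 cz.
  have oc : open (cimg (tchart t)) by exact: cimg_open.
  have yc : y \in cimg (tchart t) by exact/mem_set/Kt.
  split.
    by rewrite (iter_derive_open_eq (g := fun y => complex.Re (local_expr t psi y)) s oc)//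
      => z zc; rewrite E// ReC.
  (* Conjugation negates the imaginary part, and the absolute value absorbs the sign. *)
  rewrite (iter_derive_open_eq (g := - fun y => complex.Im (local_expr t psi y)) s oc)//.
    by rewrite iter_deriveN -[X in `|X|]/(- _) normrN.
  by move=> z zc; rewrite E// ImC.
Qed.

(** The kernel becomes [adj_section h]. Reading the integral in [inv_triv t] avoids any change of
    variables: the domain is that of [t], and the integrand is the conjugate of the desired one. *)
Lemma adjoint_is_smooth_distribution (T : functional G) :
  is_smooth_distribution T -> is_smooth_distribution (adjoint T).
Proof.
case=> dT [h sh TE]; split; first exact: adjoint_is_distribution.
exists (adj_section h); first exact: adj_section_smooth.
move=> t psi tpsi spsi; have [tpsi' spsi'] := test_adj_section tpsi.
rewrite adjointE (TE (inv_triv t))//; last first.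
  by move=> _ /spsi'[x /spsi tx <-]; rewrite /= ginvK.
rewrite -cint_conj; congr cint; apply/funext => y; rewrite cimg_inv_chart.
case: ifPn => [/set_mem cy|_]; last by rewrite conjC0.
rewrite (local_expr_inv_triv_adj_section tpsi.1 cy) (local_expr_adj_section sh cy).
by rewrite rmorphM /= conjCK.
Qed.

Lemma adjoint_fsum (A : functional G) (J : set nat) (O : nat -> functional G) :
  (fun psi => adjoint A psi - \sum_(j \in J) adjoint (O j) psi) =
  adjoint (fun psi => A psi - \sum_(j \in J) O j psi).
Proof. by apply/funext => psi; rewrite !adjointE rmorphB /= fsum_conj. Qed.

Lemma adjoint_locally_finite (J : set nat) (O : nat -> functional G) :
  locally_finite J O -> locally_finite J (fun j => adjoint (O j)).
Proof.
move=> lf x; have [W [oW Wx] fW] := lf (inv x).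
(* A test section supported in this preimage is turned by [adj_section] into one supported in
   [W]. *)
exists (inv @^-1` W); first by split=> //; exact: open_ginv_preimage.
apply: sub_finite_set fW => j [Jj [psi [tpsi spsi] On0]]; split=> //.
have [tpsi' spsi'] := test_adj_section tpsi.
exists (adj_section psi); last by rewrite adjointE conjC_eq0 in On0.
by split=> // _ /spsi'[y /spsi Wy <-].
Qed.

End Adjoint.

(** * The inversion of the cotangent groupoid in canonical coordinates *)

Section OscillatoryAdjoint.
Set Implicit Arguments.
Unset Strict Implicit.
Context {R : realType} {n k : nat} {G : lie_groupoid R n k}.
Local Notation GA := (arrows G).
Local Notation inv := (@ginv R n k G).
Local Notation dinv := (tmap inv : vec GA -> vec GA).

(** This provides an element of the set from which [inv_Gamma] chooses, so that [xget] does not fall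
    back on its default [0]. *)
Lemma cotangent_cotmap_ginv x (xi : vec GA -> R) :
  cotangent x xi -> cotangent (inv x) (cotmap inv (inv x) xi) /\
                    cotmap inv x (cotmap inv (inv x) xi) = xi.
Proof.
case=> xi0 xiD.
(* If [v] is not tangent at [inv x], then [dinv v] is not tangent at [x], so the default [0] of
   [cotmap] agrees with the value of [xi]. *)
have E v : null_off_smooth v -> cotmap inv (inv x) xi v = xi (dinv v).
  move=> v0; rewrite /cotmap; case: asboolP => // Nv; rewrite xi0// => tv.
  by apply: Nv; rewrite -[v]dinvK//; exact: tangent_dinv.
split; last first.
  apply/funext => v; rewrite [LHS]/cotmap; case: asboolP => [tv|Nv]; last by rewrite xi0.
  by rewrite E ?dinvK//; [exact: tangent_null tv|exact: dinv_null].
split; first by move=> v Nv; rewrite /cotmap asboolF.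
move=> a v w tv tw; have v0 := tangent_null tv; have w0 := tangent_null tw.
rewrite !E//; last by move=> f Nf; rewrite v0// w0// mulr0 addr0.
move: (tangent_dinv tv) (tangent_dinv tw); rewrite ginvK => tv' tw'.
rewrite -xiD//; congr xi; apply/funext => f.
rewrite !dinvE// => g Ng; by rewrite v0// w0// mulr0 addr0.
Qed.

Definition flip (p : 'rV[R]_n * 'rV[R]_n) := (p.1, - p.2).

Lemma flipK : involutive flip.
Proof. by case=> y eta; rewrite /flip /= opprK. Qed.

Lemma cotcoord_inv_Gamma (c : chart R GA n) (q : covec GA) : cotangent q.1 q.2 ->
  cotcoord (inv_chart c) (inv_Gamma q) = flip (cotcoord c q).
Proof.
case: q => x xi /= cxi; rewrite /cotcoord /flip /inv_Gamma /= ginvK; congr pair.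
have [e1 e2] := cotangent_cotmap_ginv cxi.
case: xgetP => [eta _ [ceta etaE]|/(_ _ (conj e1 e2))//].
apply/rowP => j; rewrite !mxE.
rewrite -(dinv_coord_vec c x) /= -[LHS]/(- eta _); congr (- _).
have v0 := @coord_vec_null _ _ _ _ c x j.
rewrite -etaE /cotmap; case: asboolP => // Nv.
(* Were the coordinate vector not tangent, its image under [dinv] would not be either, and [eta]
   would vanish on it. *)
by apply: ceta.1 => /(tangent_dinvE x v0).
Qed.

Lemma cotimg_inv_Gamma (c : chart R GA n) (L : set (covec GA)) p :
  L `<=` @cotangent_minus0 R n GA ->
  cotimg (inv_chart c) (@inv_Gamma R n k G @` L) p <-> cotimg c L (flip p).
Proof.
move=> L0; split.
  case=> _ [[q Lq <-] /= cq] <-.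
  exists q; first by rewrite /= ginvK in cq.
  by rewrite cotcoord_inv_Gamma ?flipK//; exact: (L0 _ Lq).1.
case=> q [Lq cq] qE; exists (inv_Gamma q).
  by split; [exists q|rewrite /= ginvK].
by rewrite cotcoord_inv_Gamma ?qE ?flipK//; exact: (L0 _ Lq).1.
Qed.

(** * Negated phases, conjugated symbols and their oscillatory integrals *)

Section Phase.
Variable N : nat.
Local Notation E := ('rV[R]_n * 'rV[R]_N)%type.
Implicit Types (V : set E) (phi : E -> R) (a : E -> R[i]).

Lemma criticalN V phi : critical V (- phi) = critical V phi.
Proof.
apply/seteqP; split=> q [Vq d0]; split=> // w; have := d0 w.
  by rewrite deriveN_total => /eqP; rewrite oppr_eq0 => /eqP.
by rewrite deriveN_total => ->; rewrite oppr0.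
Qed.

Lemma nondegenerate_phaseN U V phi :
  nondegenerate_phase U V phi -> nondegenerate_phase U V (- phi).
Proof.
case=> coneV sphi hphi dphi ndphi; split=> //.
- exact: smooth_onN.
- by move=> q t Vq t0; rewrite !fctE hphi// mulrN.
- by move=> q /dphi[v dv]; exists v; rewrite deriveN_total oppr_eq0.
- move=> q; rewrite criticalN => /ndphi nd e ev; apply: nd => v.
  apply/eqP; rewrite -oppr_eq0 -deriveN_total; apply/eqP; rewrite -(ev v).
  congr ('D_v _ q); apply/funext => q'; by rewrite deriveN_total.
Qed.

Lemma phase_lagrangianN V phi p :
  phase_lagrangian V (- phi) p <-> phase_lagrangian V phi (flip p).
Proof.
have E q : \row_j 'D_((basis_rV R j, 0) : E) (- phi) q =
           - \row_j 'D_((basis_rV R j, 0) : E) phi q.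
  by apply/rowP => j; rewrite !mxE deriveN_total.
rewrite /phase_lagrangian criticalN; split=> -[q cq].
  by move=> <-; exists q => //; rewrite E /flip /= opprK.
by move=> qE; exists q => //; rewrite E -[p]flipK -qE.
Qed.

Lemma flip_continuous : continuous flip.
Proof.
case=> y eta.
have cfst : fst z @[z --> (y, eta)] --> y by exact: cvg_fst.
have csnd : - snd z @[z --> (y, eta)] --> - eta by apply: cvgN; exact: cvg_snd.
exact: cvg_pair cfst csnd.
Qed.

Lemma parametrizesN V phi (L L' : set ('rV[R]_n * 'rV[R]_n)) :
  (forall p, L' p <-> L (flip p)) ->
  parametrizes V phi L -> parametrizes V (- phi) L'.
Proof.
move=> LL' [W oW VW]; exists (flip @^-1` W).
  by apply: open_comp oW => p _; exact: flip_continuous.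
apply/seteqP; split=> p.
  by move/phase_lagrangianN; rewrite VW => -[/LL'].
by move=> [/LL' Lp Wp]; apply/phase_lagrangianN; rewrite VW.
Qed.

Lemma symbol_conj mu a : symbol mu a -> symbol mu (fun q => (a q)^*).
Proof.
case=> aRe [sIm bIm]; split; first by under eq_fun do rewrite ReC.
under eq_fun do rewrite ImC.
rewrite -/(- (fun q => complex.Im (a q))); split; first exact: smooth_onN.
move=> K s s' cK; have [C bC] := bIm K s s' cK; exists C => y th Ky.
by rewrite iter_deriveN -[X in `|X|]/(- _) normrN; exact: bC.
Qed.

Lemma supported_in_cone_conj V a :
  supported_in_cone V a -> supported_in_cone V (fun q => (a q)^*).
Proof.
case=> B [cB BV aB]; exists B; split=> //.
by under eq_fun do rewrite conjC_eq0.
Qed.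

(** The support of [a] lies in the cone over [B], whose base points are in [U]. This disposes of the
    points outside the chart image, where test sections are not compared. *)
Lemma supported_in_cone_out U V phi a y th : nondegenerate_phase U V phi ->
  supported_in_cone V a -> ~ U y -> a (y, th) = 0.
Proof.
case=> -[_ VU _] _ _ _ _ [B [_ BV aB]] NUy.
apply/eqP/negPn/negP => an0.
have an0' : [set q | a q != 0] (y, th) := an0.
have [b Bb [t t0 [yE _]]] := interior_subset (aB _ (subset_closure an0')).
by apply: NUy; rewrite yE; have [] := VU _ (BV _ Bb).
Qed.

(** The cut-off [chi] is real, so each regularized integral is the conjugate of the original one
    with the same cut-off, and the limits follow. *)
Lemma oscillatory_integral_conj U V phi a (f g : 'rV[R]_n -> R[i]) l :
  nondegenerate_phase U V phi -> supported_in_cone V a ->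
  (forall y, U y -> g y = (f y)^*) ->
  oscillatory_integral phi a f l ->
  oscillatory_integral (- phi) (fun q => (a q)^*) g l^*.
Proof.
move=> nd sa fg osc chi schi cchi chi1 I.
have [cRe cIm] := osc chi schi cchi chi1.
have IE e : I e = (cint (fun y => cint (fun th =>
    expi (phi (y, th)) * (chi (e *: th))%:C%C * a (y, th) * f y)))^*.
  rewrite /I -cint_conj; congr cint; apply/funext => y; rewrite -cint_conj.
  congr cint; apply/funext => th; rewrite fctE expiN !rmorphM /= conj_real.
  have [Uy|NUy] := pselect (U y); first by rewrite fg.
  by rewrite (supported_in_cone_out th nd sa NUy) conjC0 !(mulr0, mul0r).
split; first by under eq_cvg do rewrite IE ReC; rewrite ReC.
under eq_cvg do rewrite IE ImC.
by rewrite ImC; exact: cvgN.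
Qed.

End Phase.

Lemma adjoint_oscillatory_distribution (m : R) (L : set (covec GA)) (O : functional G) :
  L `<=` @cotangent_minus0 R n GA ->
  oscillatory_distribution m L O ->
  oscillatory_distribution m (@inv_Gamma R n k G @` L) (adjoint O).
Proof.
move=> L0 [t [N [V [phi [a [nd par sy sa hosc]]]]]].
(* Keeping [N] keeps the order [m + (n - 2N)/4] of the symbol. *)
exists (inv_triv t), N, V, (- phi), (fun q => (a q)^*); split.
- by rewrite cimg_inv_chart; exact: nondegenerate_phaseN.
- by apply: parametrizesN par => p; exact: cotimg_inv_Gamma.
- exact: symbol_conj sy.
- exact: supported_in_cone_conj.
- move=> psi tpsi; have [tpsi' _] := test_adj_section tpsi.
  apply: (oscillatory_integral_conj nd sa _ (hosc _ tpsi')) => y cy.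
  by rewrite (local_expr_adj_section tpsi.1 cy) conjCK.
Qed.

End OscillatoryAdjoint.

Theorem theorem23 (R : realType) (n k : nat) (G : lie_groupoid R n k)
    (m : R) (Lambda : set (covec (arrows G))) (hLambda : G_relation Lambda)
    (A : functional G) (hA : lagrangian_distribution m Lambda A) :
  lagrangian_distribution m (@inv_Gamma R n k G @` Lambda) (adjoint A).
Proof.
have [[L0 _ _] _ _] := hLambda; have [dA [J [B [hB lf sm]]]] := hA.
split; first exact: adjoint_is_distribution.
exists J, (fun j => adjoint (B j)); split.
- by move=> j Jj; apply: adjoint_oscillatory_distribution => //; exact: hB.
- exact: adjoint_locally_finite.
(* Taking adjoints respects differences and these sums, so the new remainder is the adjoint of the
   old one. *)
- by rewrite adjoint_fsum; exact: adjoint_is_smooth_distribution.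
Qed.
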